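(* For every complex number $q$ with $|q|<1$, $$1+\frac{q}{(1-q)(1-q^2)}+\sum_{n=2}^\infty \frac{q^{n^2-2}(-q^2;q^2)_{n-2}(1+q^{2n+2})}{(q;q)_{2n}} = \frac{f(q^2,q^{14})}{\psi(-q)} = \frac{(-q^2,-q^{14},q^{16};q^{16})_\infty(-q;q^2)_\infty}{(q^2;q^2)_\infty}.$$
   Context: Notation: $(a;q)_n=\prod_{j=0}^{n-1}(1-aq^j)$ (so $(a;q)_0=1$), $(a;q)_\infty=\prod_{j=0}^\infty(1-aq^j)$, and $(a_1,\dots,a_r;q)_\infty=(a_1;q)_\infty\cdots(a_r;q)_\infty$; the base may be replaced by a power of $q$. Ramanujan's theta function is $f(a,b)=\sum_{n=-\infty}^\infty a^{n(n+1)/2}b^{n(n-1)/2}$ for $|ab|<1$ (with $0^0=1$), and $\psi(q)=f(q,q^3)$; $\psi(-q)$ is $\psi$ evaluated at $-q$. *)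

(* Defs.v *)
From Stdlib Require Export Reals ZArith Lia Lra.
From Coquelicot Require Export Coquelicot.

(** Coquelicot has limits and sums of complex sequences only as relations.
    As for its [RInt], the value is obtained with [iota]; it is
    meaningful when the limit exists. *)
Definition CLim_seq (u : nat -> C) : C :=
  @iota C_CompleteNormedModule (fun l : C => filterlim u eventually (locally l)).

Definition CSeries (a : nat -> C) : C :=
  @iota C_CompleteNormedModule (fun l : C => is_series a l).

Definition CSeries_from (m : nat) (a : nat -> C) : C :=
  CSeries (fun k => a (m + k)%nat).

Definition ex_CSeries_Z (t : Z -> C) : Prop :=
  ex_series (fun k => t (Z.of_nat k)) /\
  ex_series (fun k => t (- Z.of_nat (S k))%Z).

Definition CSeries_Z (t : Z -> C) : C :=
  (CSeries (fun k => t (Z.of_nat k)) +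
   CSeries (fun k => t (- Z.of_nat (S k))%Z))%C.

Fixpoint qpoch (a q : C) (n : nat) : C :=
  match n with
  | O => 1%C
  | S m => (qpoch a q m * (1 - a * q ^ m))%C
  end.

Definition qpoch_inf (a q : C) : C := CLim_seq (qpoch a q).

(** The exponents [n(n+1)/2] and [n(n-1)/2] are nonnegative for every integer
    [n], so the conversions to [nat] lose nothing; [z ^ 0 = 1] for all [z],
    including [z = 0]. *)
Definition theta_term (a b : C) (n : Z) : C :=
  (a ^ Z.to_nat (n * (n + 1) / 2) * b ^ Z.to_nat (n * (n - 1) / 2))%C.

Definition theta (a b : C) : C := CSeries_Z (theta_term a b).

Definition psi (q : C) : C := theta q (q ^ 3)%C.

(** The limits above exist on the domains where they are used. *)

Lemma CLim_seq_unique (u : nat -> C) (l : C) :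
  filterlim u eventually (locally l) -> CLim_seq u = l.
Proof.
intros H; unfold CLim_seq.
apply (@iota_unique C_AbsRing C_CompleteNormedModule); [|exact H].
intros y Hy.
exact (@filterlim_locally_unique nat C_AbsRing C_NormedModule
         eventually _ u y l Hy H).
Qed.

Lemma CSeries_unique (a : nat -> C) (l : C) : is_series a l -> CSeries a = l.
Proof. exact (CLim_seq_unique (sum_n a) l). Qed.

Lemma CSeries_correct (a : nat -> C) : ex_series a -> is_series a (CSeries a).
Proof. intros [l Hl]; rewrite (CSeries_unique a l Hl); exact Hl. Qed.

Lemma ex_series_Cmod_le (a : nat -> C) (b : nat -> R) :
  (forall n, (Cmod (a n) <= b n)%R) -> ex_series b -> ex_series a.
Proof.
intros Hab Hb.
exact (@ex_series_le C_AbsRing C_CompleteNormedModule a b Hab Hb).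
Qed.

Lemma Cmod_qpoch_le (a q : C) (n : nat) : (Cmod q < 1)%R ->
  (Cmod (qpoch a q n) <= exp (Cmod a / (1 - Cmod q)))%R.
Proof.
intros hq.
assert (H0 := Cmod_ge_0 q). assert (Ha := Cmod_ge_0 a).
apply Rle_trans with (exp (Cmod a * ((1 - Cmod q ^ n) / (1 - Cmod q)))).
- induction n as [|n IH]; simpl qpoch.
  + rewrite Cmod_1; simpl.
    replace (Cmod a * ((1 - 1) / (1 - Cmod q)))%R with 0%R by (field; lra).
    rewrite exp_0; lra.
  + rewrite Cmod_mult.
    replace (Cmod a * ((1 - Cmod q ^ S n) / (1 - Cmod q)))%R
      with (Cmod a * ((1 - Cmod q ^ n) / (1 - Cmod q)) + Cmod a * Cmod q ^ n)%R
      by (simpl; field; lra).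
    rewrite exp_plus.
    apply Rmult_le_compat; try apply Cmod_ge_0; [exact IH|].
    eapply Rle_trans; [apply Cmod_triangle|].
    rewrite Cmod_1, Cmod_opp, Cmod_mult, Cmod_pow.
    apply exp_ineq1_le.
- assert (Hn : (0 <= Cmod q ^ n)%R) by now apply pow_le.
  assert (Hi : (0 < / (1 - Cmod q))%R) by (apply Rinv_0_lt_compat; lra).
  assert (Hle : (Cmod a * ((1 - Cmod q ^ n) / (1 - Cmod q))
                 <= Cmod a / (1 - Cmod q))%R).
  { unfold Rdiv. apply Rmult_le_compat_l; [exact Ha|]. nra. }
  destruct Hle as [Hlt|Heq]; [left; now apply exp_increasing|].
  rewrite Heq; apply Rle_refl.
Qed.

Lemma qpoch_inf_correct (a q : C) : (Cmod q < 1)%R ->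
  filterlim (qpoch a q) eventually (locally (qpoch_inf a q)).
Proof.
intros hq.
assert (H0 := Cmod_ge_0 q).
set (d := fun n => (qpoch a q (S n) - qpoch a q n)%C).
assert (Hd : ex_series d).
{ apply ex_series_Cmod_le with
    (b := fun n => scal (exp (Cmod a / (1 - Cmod q)) * Cmod a)%R
                        (Cmod q ^ n)%R).
  - intros n; unfold d; simpl qpoch.
    replace (qpoch a q n * (1 - a * q ^ n) - qpoch a q n)%C
      with (- (qpoch a q n * (a * q ^ n)))%C by ring.
    rewrite Cmod_opp, !Cmod_mult, Cmod_pow.
    unfold scal; simpl; unfold mult; simpl.
    rewrite Rmult_assoc.
    apply Rmult_le_compat_r.
    + apply Rmult_le_pos; [apply Cmod_ge_0|now apply pow_le].
    + now apply Cmod_qpoch_le.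
  - apply @ex_series_scal_l.
    apply ex_series_geom; rewrite Rabs_pos_eq; lra. }
destruct Hd as [l Hl].
assert (Hs : forall n, sum_n d n = (qpoch a q (S n) - 1)%C).
{ induction n as [|n IH].
  - rewrite sum_O; reflexivity.
  - rewrite sum_Sn, IH. unfold d, plus; simpl. ring. }
assert (Hlim : filterlim (qpoch a q) eventually (locally (l + 1)%C)).
{ assert (Hshift : filterlim (fun n => qpoch a q (S n)) eventually
                     (locally (l + 1)%C)).
  { apply filterlim_ext with (f := fun n => plus (sum_n d n) (RtoC 1)).
    - intros n; rewrite Hs; unfold plus; simpl; ring.
    - eapply filterlim_comp_2;
        [exact Hl | apply filterlim_const
        | exact (@filterlim_plus C_AbsRing C_NormedModule l (RtoC 1))]. }
  intros P HP. destruct (Hshift P HP) as [N HN].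
  exists (S N). intros [|n] Hn; [lia|]. apply HN; lia. }
unfold qpoch_inf. now rewrite (CLim_seq_unique _ _ Hlim).
Qed.

Lemma ex_series_ratio (t : nat -> C) (a c : C) : (Cmod c < 1)%R ->
  (forall n, t (S n) = (c ^ n * a * t n)%C) -> ex_series t.
Proof.
intros hc Ht.
assert (H0 := Cmod_ge_0 c). assert (Ha := Cmod_ge_0 a).
assert (Heps : (0 < / (2 * (Cmod a + 1)))%R)
  by (apply Rinv_0_lt_compat; lra).
destruct (pow_lt_1_zero (Cmod c)) with (2 := Heps) as [N HN].
{ rewrite Rabs_pos_eq; lra. }
apply (ex_series_incr_n t N).
apply ex_series_Cmod_le with (b := fun n => scal (Cmod (t N)) ((/ 2) ^ n)%R).
- unfold scal; simpl; unfold mult; simpl.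
  induction n as [|n IH].
  + rewrite Nat.add_0_r; simpl; lra.
  + rewrite Nat.add_succ_r, Ht, !Cmod_mult, Cmod_pow.
    assert (Hn : (Cmod c ^ (N + n) * Cmod a <= / 2)%R).
    { assert (Hlt := HN (N + n)%nat ltac:(lia)).
      rewrite Rabs_pos_eq in Hlt by now apply pow_le.
      apply Rle_trans with (/ (2 * (Cmod a + 1)) * Cmod a)%R.
      - apply Rmult_le_compat_r; lra.
      - apply Rmult_le_reg_l with (2 * (Cmod a + 1))%R; [lra|].
        rewrite <- Rmult_assoc, Rinv_r; lra. }
    replace (Cmod (t N) * (/ 2) ^ S n)%R
      with (/ 2 * (Cmod (t N) * (/ 2) ^ n))%R by (simpl; ring).
    apply Rmult_le_compat; try assumption; try apply Cmod_ge_0.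
    apply Rmult_le_pos; [now apply pow_le|exact Ha].
- apply @ex_series_scal_l.
  apply ex_series_geom; rewrite Rabs_pos_eq; lra.
Qed.

Lemma theta_cvg (a b : C) : (Cmod (a * b) < 1)%R ->
  ex_CSeries_Z (theta_term a b).
Proof.
intros hab; split.
- apply ex_series_ratio with (a := a) (c := (a * b)%C); [exact hab|].
  intros n; unfold theta_term.
  replace (Z.of_nat (S n) * (Z.of_nat (S n) + 1))%Z
    with (Z.of_nat n * (Z.of_nat n + 1) + Z.of_nat (S n) * 2)%Z by lia.
  replace (Z.of_nat (S n) * (Z.of_nat (S n) - 1))%Z
    with (Z.of_nat n * (Z.of_nat n - 1) + Z.of_nat n * 2)%Z by lia.
  rewrite !Z.div_add by lia.
  rewrite !Z2Nat.inj_add by (try apply Z.div_pos; nia).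
  rewrite !Nat2Z.id, !Cpow_add_r, Cpow_mult_l, Cpow_S. ring.
- apply ex_series_ratio with (a := (a * b * b)%C) (c := (a * b)%C); [exact hab|].
  intros n; unfold theta_term.
  replace (- Z.of_nat (S (S n)) * (- Z.of_nat (S (S n)) + 1))%Z
    with (- Z.of_nat (S n) * (- Z.of_nat (S n) + 1)
          + Z.of_nat (S n) * 2)%Z by lia.
  replace (- Z.of_nat (S (S n)) * (- Z.of_nat (S (S n)) - 1))%Z
    with (- Z.of_nat (S n) * (- Z.of_nat (S n) - 1)
          + Z.of_nat (S (S n)) * 2)%Z by lia.
  rewrite !Z.div_add by lia.
  rewrite !Z2Nat.inj_add by (try apply Z.div_pos; nia).
  rewrite !Nat2Z.id, !Cpow_add_r, Cpow_mult_l, !Cpow_S. ring.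
Qed.

(* Main.v *)
Require Import Defs.
Open Scope C_scope.

(** The proof reduces the identity to Slater's mod 16 identity

    S := sum_(k >= 0) q^(k (k + 2)) (-q^2; q^2)_k / (q; q)_(2 k + 2)
       = f(q^2, q^14) / psi(-q),

    which is [slater_sum]. With [s_k] the terms of [S] and
    [w_k = (1 - q) q^(2 k + 2) s_k], the term of index [2 + k] of the series in
    the theorem is [s_(k + 1) + w_k - w_(k + 1)]. Hence that series sums to
    [S - s_0 + w_0], and [1 + q / ((1 - q) (1 - q^2)) - s_0 + w_0 = 0].

    To evaluate [S], note that [2 q s_k] is the term of index [k + 1] of

    sum_(n >= 0) q^(n^2) (-1; q^2)_n / ((q; q^2)_n (q^2; q^2)_n),

    whose term of index [0] is [1]. This is a limiting case of the q-Gauss sum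
    ([gauss_sum]), equal to (-q; q^2)_oo / (q; q^2)_oo, which by the Jacobi triple
    product is [psi q / psi (- q)]. So
    [1 + 2 q S = psi q / psi (- q)]. On the other hand psi(q) is the sum of
    q^(2 n^2 - n) over all integers, so its odd part is read off by keeping the
    odd [n]: [psi q - psi (- q) = 2 q f(q^2, q^14)] ([psi_odd_part]). Comparing
    the two and cancelling [2 q] gives [S]; the case [q = 0] is trivial.

    The product side of the theorem follows from the triple product for
    f(q^2, q^14) and from [psi (- q) (-q; q^2)_oo = (q^2; q^2)_oo]
    ([psi_opp_quotient]).

    Both infinite identities come from elementary ones by dominated convergence
    ([Csums_dominated]). The q-Gauss sum satisfies a first-order functional
    equation, proved by telescoping, and iterating it drives a parameter to [0].
    The triple product is the limit of a finite identity for Gaussian binomials,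
    proved by adding one factor at a time. *)

(** * Limits and sums of complex sequences *)

(** Stating convergence through the real sequence of distances gives access
    to the real limit lemmas, in particular to squeezing. *)
Definition Cconv (u : nat -> C) (l : C) : Prop :=
  is_lim_seq (fun n => Cmod (u n - l)) 0%R.

Lemma Cconv_filterlim (u : nat -> C) (l : C) :
  filterlim u eventually (locally l) <-> Cconv u l.
Proof.
rewrite (@filterlim_locally_ball_norm C_AbsRing nat C_NormedModule
  eventually filter_filter).
unfold Cconv; rewrite <- is_lim_seq_spec; unfold is_lim_seq', ball_norm.
split; intros H eps; destruct (H eps) as [N HN]; exists N; intros n Hn;
  specialize (HN n Hn).
- rewrite Rminus_0_r, Rabs_pos_eq by apply Cmod_ge_0. exact HN.
- rewrite Rminus_0_r, Rabs_pos_eq in HN by apply Cmod_ge_0. exact HN.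
Qed.

Lemma Cconv_unique (u : nat -> C) (l m : C) : Cconv u l -> Cconv u m -> l = m.
Proof.
intros Hl Hm. apply Cconv_filterlim in Hl, Hm.
rewrite <- (CLim_seq_unique u l Hl). now apply CLim_seq_unique.
Qed.

Lemma Cconv_ext (u v : nat -> C) (l : C) :
  (forall n, u n = v n) -> Cconv u l -> Cconv v l.
Proof.
intros E. apply is_lim_seq_ext. intros n; now rewrite E.
Qed.

Lemma Cconv_const (l : C) : Cconv (fun _ => l) l.
Proof.
apply is_lim_seq_ext with (fun _ => 0%R); [|apply is_lim_seq_const].
intros n. replace (l - l) with (RtoC 0) by ring. now rewrite Cmod_0.
Qed.

Lemma Cconv_squeeze (u : nat -> C) (l : C) (e : nat -> R) :
  (forall n, Cmod (u n - l) <= e n)%R -> is_lim_seq e 0%R -> Cconv u l.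
Proof.
intros He. apply is_lim_seq_le_le with (fun _ => 0%R);
  [|apply is_lim_seq_const].
intros n; split; [apply Cmod_ge_0 | apply He].
Qed.

Lemma Cconv_plus (u v : nat -> C) (l m : C) :
  Cconv u l -> Cconv v m -> Cconv (fun n => u n + v n) (l + m).
Proof.
intros Hu Hv.
apply Cconv_squeeze with (fun n => Cmod (u n - l) + Cmod (v n - m))%R.
- intros n. replace (u n + v n - (l + m)) with ((u n - l) + (v n - m)) by ring.
  apply Cmod_triangle.
- replace 0%R with (0 + 0)%R by ring. now apply is_lim_seq_plus'.
Qed.

Lemma Cconv_mult (u v : nat -> C) (l m : C) :
  Cconv u l -> Cconv v m -> Cconv (fun n => u n * v n) (l * m).
Proof.
intros Hu Hv.
apply Cconv_squeeze with (fun n => Cmod (u n - l) * Cmod (v n - m)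
  + (Cmod (u n - l) * Cmod m + Cmod l * Cmod (v n - m)))%R.
- intros n. replace (u n * v n - l * m)
    with ((u n - l) * (v n - m) + ((u n - l) * m + l * (v n - m))) by ring.
  rewrite <- !Cmod_mult.
  eapply Rle_trans; [apply Cmod_triangle|].
  apply Rplus_le_compat_l, Cmod_triangle.
- replace 0%R with (0 * 0 + (0 * Cmod m + Cmod l * 0))%R by ring.
  apply is_lim_seq_plus'; [now apply is_lim_seq_mult'|].
  apply is_lim_seq_plus'; apply is_lim_seq_mult';
    solve [assumption | apply is_lim_seq_const].
Qed.

Lemma Cconv_scal (c : C) (u : nat -> C) (l : C) :
  Cconv u l -> Cconv (fun n => c * u n) (c * l).
Proof. apply Cconv_mult, Cconv_const. Qed.

Lemma Cconv_minus (u v : nat -> C) (l m : C) :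
  Cconv u l -> Cconv v m -> Cconv (fun n => u n - v n) (l - m).
Proof.
intros Hu Hv.
apply Cconv_ext with (fun n => u n + (- (1)) * v n); [intros; ring|].
replace (l - m) with (l + (- (1)) * m) by ring.
apply Cconv_plus; [exact Hu | now apply Cconv_scal].
Qed.

Lemma Cconv_Cmod (u : nat -> C) (l : C) :
  Cconv u l -> is_lim_seq (fun n => Cmod (u n)) (Cmod l).
Proof.
intros Hu.
assert (T : forall x y, (Cmod x <= Cmod (x - y) + Cmod y)%R).
{ intros x y. replace x with (x - y + y) at 1 by ring. apply Cmod_triangle. }
apply is_lim_seq_le_le with
  (fun n => Cmod l - Cmod (u n - l))%R (fun n => Cmod l + Cmod (u n - l))%R.
- intros n. assert (H1 := T l (u n)). assert (H2 := T (u n) l).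
  replace (l - u n) with (- (u n - l)) in H1 by ring. rewrite Cmod_opp in H1.
  split; lra.
- replace (Finite (Cmod l)) with (Finite (Cmod l - 0)%R) by (f_equal; ring).
  apply is_lim_seq_minus'; [apply is_lim_seq_const | exact Hu].
- replace (Finite (Cmod l)) with (Finite (Cmod l + 0)%R) by (f_equal; ring).
  apply is_lim_seq_plus'; [apply is_lim_seq_const | exact Hu].
Qed.

Lemma Cconv_inv (u : nat -> C) (l : C) :
  (forall n, u n <> 0) -> l <> 0 -> Cconv u l -> Cconv (fun n => / u n) (/ l).
Proof.
intros Hn Hl Hu.
apply is_lim_seq_ext with (fun n => Cmod (u n - l) / (Cmod (u n) * Cmod l))%R.
- intros n. rewrite <- Cmod_mult, <- Cmod_div by (now apply Cmult_neq_0).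
  rewrite <- Cmod_opp. f_equal. field. now split.
- apply Cmod_gt_0 in Hl as Hl'.
  replace 0%R with (0 / (Cmod l * Cmod l))%R by (field; lra).
  apply is_lim_seq_div'; [exact Hu | | nra].
  apply is_lim_seq_mult'; [now apply Cconv_Cmod | apply is_lim_seq_const].
Qed.

Lemma Cconv_subseq (u : nat -> C) (l : C) (phi : nat -> nat) :
  (forall n, (n <= phi n)%nat) -> Cconv u l -> Cconv (fun n => u (phi n)) l.
Proof.
intros Hphi Hu.
apply (is_lim_seq_subseq (fun n => Cmod (u n - l)) _ phi); [|exact Hu].
intros P [N HN]. exists N. intros n Hn. apply HN. specialize (Hphi n); lia.
Qed.

Lemma Cconv_incr_1 (u : nat -> C) (l : C) :
  Cconv (fun n => u (S n)) l <-> Cconv u l.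
Proof.
unfold Cconv. symmetry.
exact (is_lim_seq_incr_1 (fun n => Cmod (u n - l)) 0%R).
Qed.

(** Summing over [k < n] rather than [k <= n] makes the empty sum available
    as the base of inductions. *)
Fixpoint csum (f : nat -> C) (n : nat) : C :=
  match n with O => 0 | S m => csum f m + f m end.

Definition Csums (f : nat -> C) (l : C) : Prop := Cconv (csum f) l.

Lemma csum_sum_n (f : nat -> C) (n : nat) :
  csum f (S n) = sum_n f n.
Proof.
induction n as [|n IH].
- rewrite sum_O. simpl. ring.
- rewrite sum_Sn, <- IH. reflexivity.
Qed.

Lemma Csums_is_series (f : nat -> C) (l : C) :
  Csums f l <-> is_series f l.
Proof.
unfold Csums. rewrite <- Cconv_incr_1.
unfold is_series. rewrite Cconv_filterlim.
split; apply Cconv_ext; intros n; [|symmetry]; apply csum_sum_n.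
Qed.

Lemma CSeries_Csums (f : nat -> C) (l : C) : Csums f l -> CSeries f = l.
Proof. intros H. now apply CSeries_unique, Csums_is_series. Qed.

Lemma ex_series_Csums (f : nat -> C) : ex_series f -> Csums f (CSeries f).
Proof. intros H. now apply Csums_is_series, CSeries_correct. Qed.

Lemma csum_ext (f g : nat -> C) (n : nat) :
  (forall k, f k = g k) -> csum f n = csum g n.
Proof. intros E. induction n as [|n IH]; simpl; congruence. Qed.

Lemma csum_plus (f g : nat -> C) (n : nat) :
  csum (fun k => f k + g k) n = csum f n + csum g n.
Proof. induction n as [|n IH]; simpl; [ring | rewrite IH; ring]. Qed.

Lemma csum_scal (c : C) (f : nat -> C) (n : nat) :
  csum (fun k => c * f k) n = c * csum f n.
Proof. induction n as [|n IH]; simpl; [ring | rewrite IH; ring]. Qed.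

Lemma csum_shift (f : nat -> C) (n : nat) :
  csum f (S n) = f O + csum (fun k => f (S k)) n.
Proof.
induction n as [|n IH]; [simpl; ring|].
change (csum f (S (S n))) with (csum f (S n) + f (S n)).
rewrite IH. simpl. ring.
Qed.

Lemma csum_telescope (f : nat -> C) (n : nat) :
  csum (fun k => f k - f (S k)) n = f O - f n.
Proof. induction n as [|n IH]; simpl; [ring | rewrite IH; ring]. Qed.

Lemma Csums_ext (f g : nat -> C) (l : C) :
  (forall k, f k = g k) -> Csums f l -> Csums g l.
Proof. intros E. apply Cconv_ext. intros n. now apply csum_ext. Qed.

Lemma Csums_plus (f g : nat -> C) (l m : C) :
  Csums f l -> Csums g m -> Csums (fun k => f k + g k) (l + m).
Proof.
intros Hf Hg. apply Cconv_ext with (fun n => csum f n + csum g n).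
- intros n. now rewrite csum_plus.
- now apply Cconv_plus.
Qed.

Lemma Csums_scal (c : C) (f : nat -> C) (l : C) :
  Csums f l -> Csums (fun k => c * f k) (c * l).
Proof.
intros Hf. apply Cconv_ext with (fun n => c * csum f n).
- intros n. now rewrite csum_scal.
- now apply Cconv_scal.
Qed.

Lemma Csums_incr_1 (f : nat -> C) (l : C) :
  Csums f l -> Csums (fun k => f (S k)) (l - f O).
Proof.
intros Hf.
apply Cconv_ext with (fun n => csum f (S n) - f O).
- intros n. rewrite csum_shift. ring.
- apply Cconv_minus; [now apply (Cconv_incr_1 (csum f)) | apply Cconv_const].
Qed.

Lemma Csums_decr_1 (f : nat -> C) (l : C) :
  Csums (fun k => f (S k)) l -> Csums f (f O + l).
Proof.
intros Hf. apply (Cconv_incr_1 (csum f)).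
apply Cconv_ext with (fun n => f O + csum (fun k => f (S k)) n).
- intros n. now rewrite csum_shift.
- apply Cconv_plus; [apply Cconv_const | exact Hf].
Qed.

Lemma Csums_lim_0 (f : nat -> C) (l : C) : Csums f l -> Cconv f 0.
Proof.
intros Hf.
apply Cconv_ext with (fun n => csum f (S n) - csum f n); [intros; simpl; ring|].
replace (RtoC 0) with (l - l) by ring.
apply Cconv_minus; [now apply (Cconv_incr_1 (csum f)) | exact Hf].
Qed.

Lemma Csums_telescope (f : nat -> C) :
  Cconv f 0 -> Csums (fun k => f k - f (S k)) (f O).
Proof.
intros Hf.
apply Cconv_ext with (fun n => f O - f n).
- intros n. now rewrite csum_telescope.
- replace (f O) with (f O - 0) at 1 by ring.
  apply Cconv_minus; [apply Cconv_const | exact Hf].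
Qed.

Lemma Csums_pairs (f g : nat -> C) (l : C) :
  (forall k, f (2 * k)%nat + f (2 * k + 1)%nat = g k) -> Csums f l -> Csums g l.
Proof.
intros H Hf.
apply Cconv_ext with (fun n => csum f (2 * n)).
- induction n as [|n IH]; [reflexivity|].
  replace (2 * S n)%nat with (S (2 * n + 1)) by lia. cbn [csum].
  rewrite <- H, <- IH, Nat.add_1_r. cbn [csum]. ring.
- apply Cconv_subseq with (phi := fun n => (2 * n)%nat); [intros; lia | exact Hf].
Qed.

Lemma sum_n_Cmod_le (a : nat -> C) (b : nat -> R) (n : nat) :
  (forall k, Cmod (a k) <= b k)%R -> (Cmod (csum a (S n)) <= sum_n b n)%R.
Proof.
intros H. induction n as [|n IH].
- rewrite sum_O. simpl. rewrite Cplus_0_l. apply H.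
- rewrite sum_Sn. change (csum a (S (S n))) with (csum a (S n) + a (S n)).
  eapply Rle_trans; [apply Cmod_triangle|]. now apply Rplus_le_compat.
Qed.

Lemma Csums_Cmod_le (a : nat -> C) (b : nat -> R) (l : C) (s : R) :
  (forall k, Cmod (a k) <= b k)%R -> Csums a l -> is_series b s ->
  (Cmod l <= s)%R.
Proof.
intros H Ha Hb.
apply (is_lim_seq_le (fun n => Cmod (csum a (S n))) (sum_n b) (Cmod l) s).
- intros n. now apply sum_n_Cmod_le.
- apply Cconv_Cmod, (Cconv_incr_1 (csum a)), Ha.
- exact Hb.
Qed.

(** Tannery's theorem. *)
Lemma Csums_dominated (u : nat -> nat -> C) (l : nat -> C) (b : nat -> R)
    (s : nat -> C) :
  (forall k n, Cmod (u k n) <= b n)%R -> ex_series b ->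
  (forall n, Cconv (fun k => u k n) (l n)) ->
  (forall k, Csums (u k) (s k)) ->
  ex_series l /\ Cconv s (CSeries l).
Proof.
intros Hb Eb Hl Hs.
assert (Hlb : forall n, (Cmod (l n) <= b n)%R).
{ intros n. apply (is_lim_seq_le (fun k => Cmod (u k n)) (fun _ => b n)
    (Cmod (l n)) (b n)).
  - intros k; apply Hb.
  - now apply Cconv_Cmod.
  - apply is_lim_seq_const. }
assert (El : ex_series l) by now apply ex_series_Cmod_le with b.
split; [exact El|].
apply ex_series_Csums in El.
(* The differences [u k n - l n] are split into the first [m] terms, which tend
   to zero one by one, and a tail bounded by twice that of [b]. *)
assert (Hd : forall k, Csums (fun n => u k n - l n) (s k - CSeries l)).
{ intros k.
  apply Csums_ext with (fun n => u k n + (- (1)) * l n); [intros; ring|].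
  replace (s k - CSeries l) with (s k + (- (1)) * CSeries l) by ring.
  apply Csums_plus; [apply Hs | now apply Csums_scal]. }
assert (Hfin : forall m, Cconv (fun k => csum (fun n => u k n - l n) m) 0).
{ induction m as [|m IH]; simpl; [apply Cconv_const|].
  replace (RtoC 0) with (0 + (l m - l m)) by ring.
  apply Cconv_plus; [exact IH|].
  apply Cconv_minus; [apply Hl | apply Cconv_const]. }
assert (Htail : forall m k, (Cmod (s k - CSeries l)
  <= Cmod (csum (fun n => u k n - l n) m)%C
     + 2 * (Series b - sum_n b m + b m))%R).
{ intros m k.
  assert (Hsh : Csums (fun n => u k (m + n)%nat - l (m + n)%nat)
    (s k - CSeries l - csum (fun n => u k n - l n) m)).
  { induction m as [|m IH].
    - simpl. replace (s k - CSeries l - 0) with (s k - CSeries l) by ring.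
      apply Hd.
    - apply Csums_incr_1 in IH.
      eapply Csums_ext; [|eapply Cconv_ext; [intros; reflexivity|]].
      2:{ simpl csum at 2. rewrite Nat.add_0_r in IH.
          replace (s k - CSeries l
            - (csum (fun n => u k n - l n) m + (u k m - l m)))
            with (s k - CSeries l - csum (fun n => u k n - l n) m
            - (u k m - l m)) by ring.
          exact IH. }
      intros j. simpl. now rewrite Nat.add_succ_r. }
  assert (Hbt : is_series (fun n => b (m + n)%nat)
                  (Series b - sum_n b m + b m)%R).
  { destruct m as [|m].
    - rewrite sum_O. replace (Series b - b O + b O)%R with (Series b) by ring.
      now apply Series_correct.
    - replace (Series b - sum_n b (S m) + b (S m))%R
        with (minus (Series b) (sum_n b m))
        by (rewrite sum_Sn; unfold minus, plus, opp; simpl; ring).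
      apply (is_series_incr_n b (S m)); [lia|].
      match goal with |- is_series _ ?x => replace x with (Series b) end;
        [|change (Series b = Series b + - sum_n b m + sum_n b m)%R; ring].
      now apply Series_correct. }
  replace (s k - CSeries l) with
    (csum (fun n => u k n - l n) m
     + (s k - CSeries l - csum (fun n => u k n - l n) m)) at 1 by ring.
  eapply Rle_trans; [apply Cmod_triangle|]. apply Rplus_le_compat_l.
  apply Csums_Cmod_le with (2 := Hsh) (b := fun n => (2 * b (m + n)%nat)%R).
  - intros n. unfold Cminus. eapply Rle_trans; [apply Cmod_triangle|].
    rewrite Cmod_opp.
    assert (H1 := Hb k (m + n)%nat). assert (H2 := Hlb (m + n)%nat). lra.
  - exact (is_series_scal (V := R_NormedModule) 2%R _ _ Hbt). }
assert (Hrem : is_lim_seq (fun m => 2 * (Series b - sum_n b m + b m))%R 0%R).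
{ replace 0%R with (2 * (Series b - Series b + 0))%R by ring.
  apply is_lim_seq_mult'; [apply is_lim_seq_const|].
  apply is_lim_seq_plus'; [apply is_lim_seq_minus'|].
  - apply is_lim_seq_const.
  - now apply Series_correct.
  - now apply ex_series_lim_0. }
apply is_lim_seq_spec. intros eps.
apply is_lim_seq_spec in Hrem.
destruct (Hrem (pos_div_2 eps)) as [m Hm]. specialize (Hm m (le_n m)).
specialize (Hfin m). apply is_lim_seq_spec in Hfin.
destruct (Hfin (pos_div_2 eps)) as [N HN].
exists N. intros k Hk. specialize (HN k Hk). specialize (Htail m k).
simpl in Hm, HN. cbv beta in Hm, HN.
rewrite Rminus_0_r in *. rewrite Rabs_pos_eq in HN |- * by apply Cmod_ge_0.
replace (csum (fun n => u k n - l n) m - 0)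
  with (csum (fun n => u k n - l n) m) in HN by ring.
apply Rabs_lt_between in Hm. lra.
Qed.

(** * Infinite products *)

Lemma qpoch_S_shift (a q : C) (n : nat) :
  qpoch a q (S n) = (1 - a) * qpoch (a * q) q n.
Proof.
induction n as [|n IH]; [simpl; ring|].
change (qpoch a q (S (S n))) with (qpoch a q (S n) * (1 - a * q ^ S n)).
rewrite IH, Cpow_S. simpl. ring.
Qed.

Lemma qpoch_even (a q : C) (n : nat) :
  qpoch a q (2 * n) = qpoch a (q ^ 2) n * qpoch (a * q) (q ^ 2) n.
Proof.
induction n as [|n IH]; [simpl; ring|].
replace (2 * S n)%nat with (S (S (2 * n))) by lia.
cbn [qpoch]. rewrite IH, <- Cpow_mult_r, (Cpow_S q (2 * n)). ring.
Qed.

Lemma qpoch_opp (a q : C) (n : nat) :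
  qpoch a q n * qpoch (- a) q n = qpoch (a ^ 2) (q ^ 2) n.
Proof.
induction n as [|n IH]; [simpl; ring|].
cbn [qpoch]. rewrite <- IH, <- Cpow_mult_r, Nat.mul_comm, Cpow_mult_r. ring.
Qed.

Lemma one_minus_ge_exp (x r : R) : (0 <= x <= r)%R -> (r < 1)%R ->
  (exp (- (x / (1 - r))) <= 1 - x)%R.
Proof.
intros Hx Hr. rewrite exp_Ropp.
assert (H1 := exp_ineq1_le (x / (1 - r))).
assert (H2 : (1 <= (1 - x) * (1 + x / (1 - r)))%R).
{ replace ((1 - x) * (1 + x / (1 - r)))%R
    with (1 + x * (r - x) / (1 - r))%R by (field; lra).
  assert (0 <= x * (r - x) / (1 - r))%R; [|lra].
  apply Rdiv_le_0_compat; [apply Rmult_le_pos|]; lra. }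
assert (Hp := exp_pos (x / (1 - r))).
apply Rmult_le_reg_r with (exp (x / (1 - r))); [exact Hp|].
rewrite Rinv_l by lra.
eapply Rle_trans; [exact H2|]. apply Rmult_le_compat_l; lra.
Qed.

(** The bound is uniform in [n], so it passes to the infinite product, and
    uniform in [a], so it serves a whole family of denominators. *)
Lemma Cmod_qpoch_ge (a q : C) (r : R) (n : nat) :
  (Cmod q < 1)%R -> (Cmod a <= r)%R -> (r < 1)%R ->
  (exp (- (r / ((1 - r) * (1 - Cmod q)))) <= Cmod (qpoch a q n))%R.
Proof.
intros hq Ha Hr.
assert (H0 := Cmod_ge_0 q). assert (Ha0 := Cmod_ge_0 a).
apply Rle_trans with
  (exp (- (r * ((1 - Cmod q ^ n) / (1 - Cmod q)) / (1 - r))))%R.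
- assert (Hn : (0 <= Cmod q ^ n)%R) by now apply pow_le.
  assert (Hi : (r * ((1 - Cmod q ^ n) / (1 - Cmod q)) / (1 - r)
            <= r / ((1 - r) * (1 - Cmod q)))%R).
  { apply Rle_trans with
      (r / ((1 - r) * (1 - Cmod q)) * (1 - Cmod q ^ n))%R;
      [right; field; lra|].
    rewrite <- (Rmult_1_r (r / ((1 - r) * (1 - Cmod q)))) at 2.
    apply Rmult_le_compat_l; [|lra].
    apply Rdiv_le_0_compat; [lra|]. apply Rmult_lt_0_compat; lra. }
  destruct (Ropp_le_contravar _ _ Hi) as [Hlt|Heq];
    [left; now apply exp_increasing | right; now rewrite Heq].
- induction n as [|n IH]; simpl qpoch.
  + rewrite Cmod_1; simpl.
    replace (- (r * ((1 - 1) / (1 - Cmod q)) / (1 - r)))%R with 0%R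
      by (field; lra).
    rewrite exp_0; lra.
  + rewrite Cmod_mult.
    replace (- (r * ((1 - Cmod q ^ S n) / (1 - Cmod q)) / (1 - r)))%R
      with (- (r * ((1 - Cmod q ^ n) / (1 - Cmod q)) / (1 - r))
            + - ((r * Cmod q ^ n) / (1 - r)))%R
      by (simpl; field; lra).
    rewrite exp_plus.
    apply Rmult_le_compat; try (left; apply exp_pos); [exact IH|].
    assert (Hn : (0 <= Cmod q ^ n <= 1)%R).
    { split; [now apply pow_le|].
      rewrite <- (pow1 n). apply pow_incr; lra. }
    eapply Rle_trans; [apply one_minus_ge_exp; [nra | exact Hr]|].
    apply Rle_trans with (1 - Cmod (a * q ^ n))%R.
    * rewrite Cmod_mult, Cmod_pow. nra.
    * assert (T := Cmod_triangle (1 - a * q ^ n) (a * q ^ n)).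
      replace (1 - a * q ^ n + a * q ^ n) with (RtoC 1) in T by ring.
      rewrite Cmod_1 in T. lra.
Qed.

Lemma qpoch_neq_0 (a q : C) (n : nat) :
  (Cmod q < 1)%R -> (Cmod a < 1)%R -> qpoch a q n <> 0.
Proof.
intros hq Ha E.
assert (H := Cmod_qpoch_ge a q (Cmod a) n hq (Rle_refl _) Ha).
rewrite E, Cmod_0 in H.
assert (P := exp_pos (- (Cmod a / ((1 - Cmod a) * (1 - Cmod q))))). lra.
Qed.

Lemma qpoch_inf_Cconv (a q : C) :
  (Cmod q < 1)%R -> Cconv (qpoch a q) (qpoch_inf a q).
Proof. intros hq. now apply Cconv_filterlim, qpoch_inf_correct. Qed.

Lemma qpoch_inf_neq_0 (a q : C) :
  (Cmod q < 1)%R -> (Cmod a < 1)%R -> qpoch_inf a q <> 0.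
Proof.
intros hq Ha E.
assert (L := Cconv_Cmod _ _ (qpoch_inf_Cconv a q hq)).
assert (P := exp_pos (- (Cmod a / ((1 - Cmod a) * (1 - Cmod q))))).
assert (H := is_lim_seq_le
  (fun _ => exp (- (Cmod a / ((1 - Cmod a) * (1 - Cmod q)))))
  _ _ _ (fun n => Cmod_qpoch_ge a q (Cmod a) n hq (Rle_refl _) Ha)
  (is_lim_seq_const _) L).
simpl in H. rewrite E, Cmod_0 in H. lra.
Qed.

Lemma Cmod_pow_lt_1 (q : C) (n : nat) :
  (0 < n)%nat -> (Cmod q < 1)%R -> (Cmod (q ^ n) < 1)%R.
Proof.
intros Hn hq. rewrite Cmod_pow. apply pow_lt_1_compat; [|exact Hn].
split; [apply Cmod_ge_0 | exact hq].
Qed.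

Lemma qpoch_inf_even (a q : C) : (Cmod q < 1)%R ->
  qpoch_inf a q = qpoch_inf a (q ^ 2) * qpoch_inf (a * q) (q ^ 2).
Proof.
intros hq. assert (hq2 := Cmod_pow_lt_1 q 2 ltac:(lia) hq).
apply Cconv_unique with (fun n => qpoch a q (2 * n)).
- apply Cconv_subseq with (phi := fun n => (2 * n)%nat); [intros; lia|].
  now apply qpoch_inf_Cconv.
- apply Cconv_ext with (fun n => qpoch a (q ^ 2) n * qpoch (a * q) (q ^ 2) n).
  + intros n. now rewrite qpoch_even.
  + now apply Cconv_mult; apply qpoch_inf_Cconv.
Qed.

Lemma qpoch_inf_opp (a q : C) : (Cmod q < 1)%R ->
  qpoch_inf a q * qpoch_inf (- a) q = qpoch_inf (a ^ 2) (q ^ 2).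
Proof.
intros hq. assert (hq2 := Cmod_pow_lt_1 q 2 ltac:(lia) hq).
apply Cconv_unique with (fun n => qpoch a q n * qpoch (- a) q n).
- now apply Cconv_mult; apply qpoch_inf_Cconv.
- apply Cconv_ext with (qpoch (a ^ 2) (q ^ 2)).
  + intros n. now rewrite qpoch_opp.
  + now apply qpoch_inf_Cconv.
Qed.

(** * Absolute convergence *)

Lemma ex_series_RtoC (b : nat -> R) :
  ex_series (fun n => RtoC (b n)) -> ex_series b.
Proof.
intros [l Hl]. exists (fst l).
apply filterlim_ext with (fun n => fst (sum_n (fun n => RtoC (b n)) n)).
- induction x as [|n IH]; [now rewrite !sum_O|].
  rewrite !sum_Sn, <- IH. reflexivity.
- eapply filterlim_comp; [exact Hl|]. destruct l as [x y].
  apply continuous_fst.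
Qed.

Lemma ex_series_Cmod_ratio (t : nat -> C) (a c : C) : (Cmod c < 1)%R ->
  (forall n, t (S n) = c ^ n * a * t n) -> ex_series (fun n => Cmod (t n)).
Proof.
intros hc Ht. apply ex_series_RtoC.
apply ex_series_ratio with (a := RtoC (Cmod a)) (c := RtoC (Cmod c)).
- rewrite Cmod_R, Rabs_pos_eq by apply Cmod_ge_0. exact hc.
- intros n. rewrite Ht, !Cmod_mult, Cmod_pow, !RtoC_mult, RtoC_pow. reflexivity.
Qed.

Lemma Cmod_theta_term (a b : C) (n : Z) :
  theta_term (RtoC (Cmod a)) (RtoC (Cmod b)) n = RtoC (Cmod (theta_term a b n)).
Proof.
unfold theta_term. now rewrite Cmod_mult, !Cmod_pow, RtoC_mult, !RtoC_pow.
Qed.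

Lemma ex_series_Cmod_theta_term (a b : C) : (Cmod (a * b) < 1)%R ->
  ex_series (fun k => Cmod (theta_term a b (Z.of_nat k))) /\
  ex_series (fun k => Cmod (theta_term a b (- Z.of_nat (S k)))).
Proof.
intros hab.
destruct (theta_cvg (RtoC (Cmod a)) (RtoC (Cmod b))) as [H1 H2].
- rewrite <- RtoC_mult, <- Cmod_mult, Cmod_R, Rabs_pos_eq by apply Cmod_ge_0.
  exact hab.
- split; apply ex_series_RtoC; [revert H1 | revert H2];
    apply ex_series_ext; intros n; apply Cmod_theta_term.
Qed.

(** * A limiting case of the q-Gauss sum *)

(** The terms of the series 2phi1(a, b; c; q^2, c / (a b)) in the limit
    [b -> oo], with [c = a q y]: this parameter [y] makes the power of [q]
    the integral exponent [n^2] and avoids dividing by [a]. *)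
Definition gauss_term (a q y : C) (n : nat) : C :=
  (- y) ^ n * q ^ (n * n) * qpoch a (q ^ 2) n
  / (qpoch (q ^ 2) (q ^ 2) n * qpoch (a * q * y) (q ^ 2) n).

(** Its only dependence on the denominator (aqy; q^2)_n is through a bound [r]
    on [|a q y|], so that one summable sequence dominates the series at all
    points [y q^(2 k)]. *)
Definition gauss_bound (a q y : C) (r : R) (n : nat) : R :=
  (exp (Cmod a / (1 - Cmod (q ^ 2)))
   * exp (Cmod (q ^ 2) / ((1 - Cmod (q ^ 2)) * (1 - Cmod (q ^ 2))))
   * exp (r / ((1 - r) * (1 - Cmod (q ^ 2))))
   * Cmod ((- y) ^ n * q ^ (n * n)))%R.

Lemma ex_series_gauss_bound (a q y : C) (r : R) :
  (Cmod q < 1)%R -> ex_series (gauss_bound a q y r).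
Proof.
intros hq. apply @ex_series_scal_l.
apply ex_series_Cmod_ratio with (a := - (q * y)) (c := q ^ 2).
- apply Cmod_pow_lt_1; [lia | exact hq].
- intros n. replace (S n * S n)%nat with (n * n + (2 * n + 1))%nat by lia.
  rewrite !Cpow_add_r, (Cpow_mult_r q 2 n), Cpow_S. ring.
Qed.

Lemma Cmod_gauss_term_le (a q y : C) (r : R) (n : nat) :
  (Cmod q < 1)%R -> (Cmod (a * q * y) <= r)%R -> (r < 1)%R ->
  (Cmod (gauss_term a q y n) <= gauss_bound a q y r n)%R.
Proof.
intros hq Hy Hr. assert (hq2 := Cmod_pow_lt_1 q 2 ltac:(lia) hq).
unfold gauss_term, gauss_bound.
assert (N1 := qpoch_neq_0 (q ^ 2) (q ^ 2) n hq2 hq2).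
assert (N2 := qpoch_neq_0 (a * q * y) (q ^ 2) n hq2 ltac:(lra)).
rewrite Cmod_div by (now apply Cmult_neq_0).
rewrite !Cmod_mult. unfold Rdiv at 1. rewrite Rinv_mult.
assert (B0 := Cmod_qpoch_le a (q ^ 2) n hq2).
assert (B1 := Cmod_qpoch_ge (q ^ 2) (q ^ 2) _ n hq2 (Rle_refl _) hq2).
assert (B2 := Cmod_qpoch_ge (a * q * y) (q ^ 2) r n hq2 Hy Hr).
rewrite exp_Ropp in B1, B2.
apply Rinv_le_contravar in B1, B2; try (apply Rinv_0_lt_compat, exp_pos).
rewrite Rinv_inv in B1, B2.
set (A := Cmod ((- y) ^ n)). set (B := Cmod (q ^ (n * n))).
assert (HA : (0 <= A * B)%R) by (apply Rmult_le_pos; apply Cmod_ge_0).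
apply Cmod_gt_0 in N1, N2.
apply Rinv_0_lt_compat in N1, N2.
match goal with |- (_ * ?x * (?i * ?j) <= _ * _ * _ * _)%R =>
  replace (A * B * x * (i * j))%R with ((x * i * j) * (A * B))%R by ring end.
apply Rmult_le_compat_r; [exact HA|].
apply Rmult_le_compat; [|lra| |exact B2].
{ apply Rmult_le_pos; [apply Cmod_ge_0 | lra]. }
apply Rmult_le_compat; [apply Cmod_ge_0 | lra | exact B0 | exact B1].
Qed.

Lemma Csums_gauss_term (a q y : C) :
  (Cmod q < 1)%R -> (Cmod (a * q * y) < 1)%R ->
  Csums (gauss_term a q y) (CSeries (gauss_term a q y)).
Proof.
intros hq Hy. apply ex_series_Csums.
apply ex_series_Cmod_le with (gauss_bound a q y (Cmod (a * q * y))).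
- intros n. now apply Cmod_gauss_term_le; [|apply Rle_refl|].
- now apply ex_series_gauss_bound.
Qed.

(** Termwise, the difference of the two sides is [H n - H (S n)], where [H n] is
    the [n]th term of the series at [y] times [(1 - a q y) (1 - q^(2 n))];
    [H 0 = 0] and [H] tends to [0]. *)
Lemma gauss_sum_step (a q y : C) :
  (Cmod q < 1)%R -> (Cmod (a * q * y) < 1)%R ->
  (1 - a * q * y) * CSeries (gauss_term a q y)
  = (1 - q * y) * CSeries (gauss_term a q (y * q ^ 2)).
Proof.
intros hq Hy. assert (hq2 := Cmod_pow_lt_1 q 2 ltac:(lia) hq).
assert (Hy2 : (Cmod (a * q * (y * q ^ 2)) < 1)%R).
{ replace (a * q * (y * q ^ 2)) with (a * q * y * q ^ 2) by ring.
  rewrite Cmod_mult.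
  assert (H1 := Cmod_ge_0 (a * q * y)). assert (H2 := Cmod_ge_0 (q ^ 2)). nra. }
assert (S1 := Csums_gauss_term a q y hq Hy).
assert (S2 := Csums_gauss_term a q (y * q ^ 2) hq Hy2).
set (H := fun n => (1 - a * q * y) * gauss_term a q y n
  - (1 - a * q * y) * (q ^ 2) ^ n * gauss_term a q y n).
assert (H0 : H O = 0) by (unfold H; simpl; ring).
assert (Hlim : Cconv H 0).
{ unfold H.
  replace (RtoC 0) with ((1 - a * q * y) * 0 - (1 - a * q * y) * 0 * 0) by ring.
  assert (L := Csums_lim_0 _ _ S1).
  apply Cconv_minus; [now apply Cconv_scal|].
  apply Cconv_mult; [|exact L]. apply Cconv_scal.
  apply Cconv_squeeze with (fun n => Cmod (q ^ 2) ^ n)%R.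
  - intros n. replace ((q ^ 2) ^ n - 0) with ((q ^ 2) ^ n) by ring.
    rewrite (Cmod_pow (q ^ 2)). apply Rle_refl.
  - apply is_lim_seq_geom. rewrite Rabs_pos_eq by apply Cmod_ge_0. exact hq2. }
assert (E : forall n, (1 - a * q * y) * gauss_term a q y n
   + (- (1 - q * y)) * gauss_term a q (y * q ^ 2) n = H n - H (S n)).
{ intros n. unfold H, gauss_term.
  assert (N1 := qpoch_neq_0 (q ^ 2) (q ^ 2) (S n) hq2 hq2).
  assert (N2 := qpoch_neq_0 (a * q * y) (q ^ 2) (S n) hq2 Hy).
  assert (N3 := qpoch_neq_0 (a * q * (y * q ^ 2)) (q ^ 2) n hq2 Hy2).
  assert (E3 := qpoch_S_shift (a * q * y) (q ^ 2) n).
  replace (a * q * y * q ^ 2) with (a * q * (y * q ^ 2)) in E3 by ring.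
  assert (N4 : 1 - a * q * y <> 0).
  { intros Z. rewrite E3, Z in N2. apply N2. ring. }
  replace (- (y * q ^ 2)) with (- y * q ^ 2) by ring.
  replace (S n * S n)%nat with (n * n + (2 * n + 1))%nat by lia.
  rewrite (Cpow_mult_l (- y)), !Cpow_add_r, (Cpow_mult_r q 2 n).
  assert (E4 : qpoch (a * q * (y * q ^ 2)) (q ^ 2) n
    = qpoch (a * q * y) (q ^ 2) n * (1 - a * q * y * (q ^ 2) ^ n)
      / (1 - a * q * y)).
  { change (qpoch (a * q * y) (q ^ 2) n * (1 - a * q * y * (q ^ 2) ^ n))
      with (qpoch (a * q * y) (q ^ 2) (S n)).
    rewrite E3. now field. }
  rewrite E4. cbn [qpoch] in *. rewrite !Cpow_S.
  replace (1 - q ^ 2 * (q ^ 2) ^ n) with (1 - q * (q * 1) * (q ^ 2) ^ n) in *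
    by (simpl; ring).
  change (q ^ 2) with (q * (q * 1)) in *. change (q ^ 1) with (q * 1).
  change (q ^ 0) with (RtoC 1).
  set (Q := (q * (q * 1)) ^ n) in *.
  set (P1 := qpoch (q * (q * 1)) (q * (q * 1)) n) in *.
  set (P2 := qpoch (a * q * y) (q * (q * 1)) n) in *.
  set (P0 := qpoch a (q * (q * 1)) n) in *.
  clearbody Q P0 P1 P2.
  assert (P1 <> 0) by (intros Z; apply N1; rewrite Z; ring).
  assert (P2 <> 0) by (intros Z; apply N2; rewrite Z; ring).
  assert (1 - q * q * Q <> 0).
  { intros Z; apply N1. transitivity (P1 * (1 - q * q * Q)); [ring|].
    rewrite Z; ring. }
  assert (1 - a * q * y * Q <> 0) by (intros Z; apply N2; rewrite Z; ring).
  field. repeat split; assumption. }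
assert (T := Csums_telescope H Hlim).
assert (U := Csums_plus _ _ _ _ (Csums_scal (1 - a * q * y) _ _ S1)
  (Csums_scal (- (1 - q * y)) _ _ S2)).
apply (Csums_ext _ _ _ E) in U.
assert (V := Cconv_unique _ _ _ U T). rewrite H0 in V.
match type of V with ?x + _ = _ =>
  transitivity (x + - (1 - q * y) * CSeries (gauss_term a q (y * q ^ 2))
    + (1 - q * y) * CSeries (gauss_term a q (y * q ^ 2))); [ring|] end.
rewrite V. ring.
Qed.

(** Iterating the functional equation drives [y] to [0], where only the first
    term survives. *)
Lemma gauss_sum (a q y : C) :
  (Cmod q < 1)%R -> (Cmod (a * q * y) < 1)%R ->
  CSeries (gauss_term a q y) * qpoch_inf (a * q * y) (q ^ 2)
  = qpoch_inf (q * y) (q ^ 2).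
Proof.
intros hq Hy. assert (hq2 := Cmod_pow_lt_1 q 2 ltac:(lia) hq).
assert (Hq0 := Cmod_ge_0 (q ^ 2)).
assert (Hz : forall k, (0 <= Cmod (q ^ 2) ^ k <= 1)%R).
{ intros k. split; [now apply pow_le|].
  rewrite <- (pow1 k). apply pow_incr; lra. }
assert (Hyk : forall k, (Cmod (a * q * (y * (q ^ 2) ^ k)) <= Cmod (a * q * y))%R).
{ intros k. replace (a * q * (y * (q ^ 2) ^ k))
    with (a * q * y * (q ^ 2) ^ k) by ring.
  rewrite Cmod_mult, (Cmod_pow (q ^ 2)).
  assert (H1 := Cmod_ge_0 (a * q * y)). specialize (Hz k). nra. }
assert (It : forall k,
  CSeries (gauss_term a q y) * qpoch (a * q * y) (q ^ 2) k
  = qpoch (q * y) (q ^ 2) k * CSeries (gauss_term a q (y * (q ^ 2) ^ k))).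
{ induction k as [|k IH].
  - simpl. replace (y * 1) with y by ring. ring.
  - cbn [qpoch]. rewrite Cmult_assoc, IH.
    assert (St := gauss_sum_step a q (y * (q ^ 2) ^ k) hq
      ltac:(specialize (Hyk k); lra)).
    replace (y * (q ^ 2) ^ k * q ^ 2) with (y * (q ^ 2) ^ S k) in St
      by (rewrite Cpow_S; ring).
    transitivity (qpoch (q * y) (q ^ 2) k * ((1 - a * q * (y * (q ^ 2) ^ k))
      * CSeries (gauss_term a q (y * (q ^ 2) ^ k)))); [ring|].
    rewrite St. ring. }
set (l := fun n : nat => match n with O => RtoC 1 | S _ => RtoC 0 end).
assert (Hl : Csums l 1).
{ replace (RtoC 1) with (l O + 0) by (simpl; ring).
  apply Csums_decr_1.
  apply Cconv_ext with (fun _ => RtoC 0); [|apply Cconv_const].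
  induction n as [|n IH]; simpl in *; [reflexivity | rewrite <- IH; ring]. }
assert (Hb : forall k n, (Cmod (gauss_term a q (y * (q ^ 2) ^ k) n)
  <= (Cmod (q ^ 2) ^ k) ^ n * gauss_bound a q y (Cmod (a * q * y)) n)%R).
{ intros k n.
  eapply Rle_trans.
  - apply Cmod_gauss_term_le with (r := Cmod (a * q * y));
      [exact hq | apply Hyk | exact Hy].
  - unfold gauss_bound. right.
    replace (- (y * (q ^ 2) ^ k)) with (- y * (q ^ 2) ^ k) by ring.
    rewrite (Cpow_mult_l (- y)), !Cmod_mult, (Cmod_pow ((q ^ 2) ^ k) n),
      (Cmod_pow (q ^ 2) k). ring. }
assert (Hnn : forall n, (0 <= gauss_bound a q y (Cmod (a * q * y)) n)%R).
{ intros n. eapply Rle_trans; [apply Cmod_ge_0|].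
  now apply (Cmod_gauss_term_le a q y _ n); [|apply Rle_refl|]. }
assert (L : Cconv (fun k => CSeries (gauss_term a q (y * (q ^ 2) ^ k))) 1).
{ rewrite <- (CSeries_Csums l 1 Hl).
  apply Csums_dominated with (u := fun k => gauss_term a q (y * (q ^ 2) ^ k))
    (b := gauss_bound a q y (Cmod (a * q * y))).
  - intros k n. eapply Rle_trans; [apply Hb|].
    rewrite <- (Rmult_1_l (gauss_bound _ _ _ _ n)) at 2.
    apply Rmult_le_compat_r; [apply Hnn|].
    rewrite <- (pow1 n). apply pow_incr, Hz.
  - now apply ex_series_gauss_bound.
  - intros [|n].
    + apply Cconv_ext with (fun _ => RtoC 1); [|apply Cconv_const].
      intros k. unfold gauss_term. simpl. now field.
    + apply Cconv_squeeze with (fun k => Cmod (q ^ 2) ^ k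
        * gauss_bound a q y (Cmod (a * q * y)) (S n))%R.
      * intros k. simpl l.
        replace (gauss_term a q (y * (q ^ 2) ^ k) (S n) - 0)
          with (gauss_term a q (y * (q ^ 2) ^ k) (S n)) by ring.
        eapply Rle_trans; [apply Hb|].
        apply Rmult_le_compat_r; [apply Hnn|].
        specialize (Hz k). set (z := (Cmod (q ^ 2) ^ k)%R) in *.
        change (z ^ S n)%R with (z * z ^ n)%R.
        rewrite <- (Rmult_1_r z) at 3.
        apply Rmult_le_compat_l; [lra|].
        rewrite <- (pow1 n). now apply pow_incr.
      * replace 0%R with (0 * gauss_bound a q y (Cmod (a * q * y)) (S n))%R
          by ring.
        apply is_lim_seq_mult'; [|apply is_lim_seq_const].
        apply is_lim_seq_geom. now rewrite Rabs_pos_eq.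
  - intros k. apply Csums_gauss_term; [exact hq|]. specialize (Hyk k); lra. }
apply Cconv_unique with (fun k => CSeries (gauss_term a q y)
  * qpoch (a * q * y) (q ^ 2) k).
- now apply Cconv_scal, qpoch_inf_Cconv.
- apply Cconv_ext with (fun k => qpoch (q * y) (q ^ 2) k
    * CSeries (gauss_term a q (y * (q ^ 2) ^ k))).
  + intros k. now rewrite It.
  + replace (qpoch_inf (q * y) (q ^ 2)) with (qpoch_inf (q * y) (q ^ 2) * 1)
      by ring.
    apply Cconv_mult; [now apply qpoch_inf_Cconv | exact L].
Qed.

(** * The Jacobi triple product *)

(** Defined by the Pascal rule rather than as a quotient, so that the finite
    triple product is an identity of polynomials and the coefficients vanish
    beyond [k = M]. *)
Fixpoint gauss_binom (q : C) (M k : nat) : C :=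
  match k with
  | O => 1
  | S k' => match M with
            | O => 0
            | S M' => gauss_binom q M' k' + q ^ S k' * gauss_binom q M' (S k')
            end
  end.

Lemma gauss_binom_0 (q : C) (M : nat) : gauss_binom q M 0 = 1.
Proof. now destruct M. Qed.

Lemma gauss_binom_gt (q : C) (M k : nat) :
  (M < k)%nat -> gauss_binom q M k = 0.
Proof.
revert k. induction M as [|M IH]; intros [|k] H; try lia; [reflexivity|].
cbn [gauss_binom]. rewrite !IH by lia. ring.
Qed.

Lemma gauss_binom_pascal (q : C) (M k : nat) : (k <= M)%nat ->
  gauss_binom q (S M) (S k)
  = gauss_binom q M (S k) + q ^ (M - k) * gauss_binom q M k.
Proof.
revert k. induction M as [|M IH]; intros k H.
- replace k with O by lia. simpl. ring.
- change (gauss_binom q (S (S M)) (S k))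
    with (gauss_binom q (S M) k + q ^ S k * gauss_binom q (S M) (S k)).
  destruct k as [|k].
  + assert (E1 := IH 0%nat ltac:(lia)).
    assert (E2 : gauss_binom q (S M) 1 = 1 + q * gauss_binom q M 1).
    { cbn [gauss_binom]. rewrite gauss_binom_0. simpl. ring. }
    rewrite gauss_binom_0, Nat.sub_0_r in *.
    transitivity (1 + q * (gauss_binom q M 1 + q ^ M)).
    * rewrite E1. simpl. ring.
    * rewrite E2, (Cpow_S q M). ring.
  + change (S M - S k)%nat with (M - k)%nat.
    assert (E : q ^ S (S k) * gauss_binom q (S M) (S (S k))
      = q ^ S (S k) * gauss_binom q M (S (S k))
        + q ^ (M - k) * q ^ S k * gauss_binom q M (S k)).
    { destruct (Nat.eq_dec k M) as [->|Hk].
      - rewrite !gauss_binom_gt by lia. ring.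
      - rewrite (IH (S k)) by lia.
        rewrite Cmult_plus_distr_l, Cmult_assoc, <- !Cpow_add_r.
        now replace (S (S k) + (M - S k))%nat with (M - k + S k)%nat by lia. }
    assert (E1 := IH k ltac:(lia)).
    assert (E2 : gauss_binom q (S M) (S (S k))
      = gauss_binom q M (S k) + q ^ S (S k) * gauss_binom q M (S (S k)))
      by reflexivity.
    assert (E3 : gauss_binom q (S M) (S k)
      = gauss_binom q M k + q ^ S k * gauss_binom q M (S k)) by reflexivity.
    rewrite E, E2. rewrite E1 at 1. rewrite E3. ring.
Qed.

Lemma gauss_binom_qpoch (q : C) (k j : nat) :
  gauss_binom q (k + j) k * (qpoch q q k * qpoch q q j) = qpoch q q (k + j).
Proof.
remember (k + j)%nat as n eqn:En. revert k j En.
induction n as [|n IH]; intros k j En.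
- replace k with O by lia. replace j with O by lia. simpl. ring.
- destruct k as [|k].
  + replace j with (S n) by lia. rewrite gauss_binom_0. simpl. ring.
  + cbn [gauss_binom].
    assert (E1 := IH k j ltac:(lia)).
    destruct j as [|j].
    * rewrite (gauss_binom_gt q n (S k)) by lia.
      replace k with n in * by lia. cbn [qpoch] in *.
      rewrite <- E1 at 2. ring.
    * assert (E2 := IH (S k) j ltac:(lia)).
      transitivity ((1 - q * q ^ k)
          * (gauss_binom q n k * (qpoch q q k * qpoch q q (S j)))
        + q ^ S k * (1 - q * q ^ j)
          * (gauss_binom q n (S k) * (qpoch q q (S k) * qpoch q q j))).
      { cbn [qpoch]. ring. }
      rewrite E1, E2. cbn [qpoch].
      replace n with (S k + j)%nat at 4 by lia.
      rewrite Cpow_add_r, !Cpow_S. ring.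
Qed.

Lemma csum_ext_lt (f g : nat -> C) (n : nat) :
  (forall k, (k < n)%nat -> f k = g k) -> csum f n = csum g n.
Proof.
intros E. induction n as [|n IH]; [reflexivity|]. simpl.
rewrite E by lia. rewrite IH; [reflexivity|]. intros; apply E; lia.
Qed.

(** One more factor on the right of the product, absorbed by the Pascal rule
    with weight [q ^ (M - k)]. *)
Lemma gauss_binom_sum_up (q x : C) (tau : nat -> C) (M : nat) :
  (forall k, (k <= M)%nat -> x * tau k = q ^ (M - k) * tau (S k)) ->
  (1 + x) * csum (fun k => gauss_binom q M k * tau k) (S M)
  = csum (fun k => gauss_binom q (S M) k * tau k) (S (S M)).
Proof.
intros H. rewrite (csum_shift _ (S M)).
rewrite (csum_ext_lt (fun k => gauss_binom q (S M) (S k) * tau (S k))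
  (fun k => gauss_binom q M (S k) * tau (S k)
            + x * (gauss_binom q M k * tau k))).
- rewrite csum_plus, csum_scal.
  assert (E := csum_shift (fun k => gauss_binom q M k * tau k) (S M)).
  change (csum (fun k => gauss_binom q M k * tau k) (S (S M))) with
    (csum (fun k => gauss_binom q M k * tau k) (S M)
     + gauss_binom q M (S M) * tau (S M)) in E.
  rewrite gauss_binom_gt, gauss_binom_0 in E by lia.
  rewrite gauss_binom_0, Cplus_assoc, <- E. ring.
- intros k Hk. rewrite gauss_binom_pascal by lia.
  transitivity (gauss_binom q M (S k) * tau (S k)
    + gauss_binom q M k * (q ^ (M - k) * tau (S k))); [ring|].
  rewrite <- H by lia. ring.
Qed.

(** One more factor on the left, absorbed by the Pascal rule with weight
    [q ^ k]; the new leftmost term shifts the index by one. *)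
Lemma gauss_binom_sum_down (q x : C) (tau : nat -> C) (M : nat) :
  (forall k, x * tau (S k) = q ^ k * tau k) ->
  (1 + x) * csum (fun k => gauss_binom q M k * tau (S k)) (S M)
  = csum (fun k => gauss_binom q (S M) k * tau k) (S (S M)).
Proof.
intros H. rewrite (csum_shift _ (S M)).
rewrite (csum_ext (fun k => gauss_binom q (S M) (S k) * tau (S k))
  (fun k => gauss_binom q M k * tau (S k)
            + q ^ S k * gauss_binom q M (S k) * tau (S k))).
2:{ intros k. cbn [gauss_binom]. ring. }
rewrite csum_plus.
assert (E := csum_shift (fun k => q ^ k * gauss_binom q M k * tau k) (S M)).
change (csum (fun k => q ^ k * gauss_binom q M k * tau k) (S (S M))) with
  (csum (fun k => q ^ k * gauss_binom q M k * tau k) (S M)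
   + q ^ S M * gauss_binom q M (S M) * tau (S M)) in E.
rewrite gauss_binom_gt, gauss_binom_0 in E by lia.
rewrite (csum_ext (fun k => q ^ k * gauss_binom q M k * tau k)
  (fun k => x * (gauss_binom q M k * tau (S k)))), csum_scal in E.
2:{ intros k.
    transitivity (gauss_binom q M k * (q ^ k * tau k)); [ring|].
    rewrite <- H. ring. }
rewrite gauss_binom_0.
transitivity (csum (fun k => gauss_binom q M k * tau (S k)) (S M)
  + (x * csum (fun k => gauss_binom q M k * tau (S k)) (S M)
     + q ^ S M * 0 * tau (S M))); [ring|].
rewrite E. simpl. ring.
Qed.

Lemma theta_exponents (r : Z) :
  (Z.of_nat (Z.to_nat (r * (r + 1) / 2)) * 2 = r * (r + 1) /\
   Z.of_nat (Z.to_nat (r * (r - 1) / 2)) * 2 = r * (r - 1))%Z.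
Proof.
assert (E : (exists m, r = 2 * m \/ r = 2 * m + 1)%Z).
{ destruct (Z.Even_or_Odd r) as [[m Hm]|[m Hm]]; exists m; lia. }
destruct E as [m [->| ->]]; assert (m <= -1 \/ m = 0 \/ 1 <= m)%Z by lia.
- replace (2 * m * (2 * m + 1))%Z with (m * (2 * m + 1) * 2)%Z by ring.
  replace (2 * m * (2 * m - 1))%Z with (m * (2 * m - 1) * 2)%Z by ring.
  rewrite !Z.div_mul, !Z2Nat.id by nia. split; ring.
- replace ((2 * m + 1) * (2 * m + 1 + 1))%Z
    with ((2 * m + 1) * (m + 1) * 2)%Z by ring.
  replace ((2 * m + 1) * (2 * m + 1 - 1))%Z with ((2 * m + 1) * m * 2)%Z by ring.
  rewrite !Z.div_mul, !Z2Nat.id by nia. split; ring.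
Qed.

(** The quotient of consecutive terms is [a (a b)^r], whose exponent may be
    negative; multiplying by [(a b)^(m - r)] for some [m >= r] makes every
    exponent natural. *)
Lemma theta_term_up (a b : C) (m j : nat) (r : Z) :
  (Z.of_nat m - r)%Z = Z.of_nat j ->
  a * (a * b) ^ m * theta_term a b r = (a * b) ^ j * theta_term a b (r + 1).
Proof.
intros H. unfold theta_term.
destruct (theta_exponents r) as [H1 H2].
destruct (theta_exponents (r + 1)) as [H3 H4].
set (e1 := Z.to_nat (r * (r + 1) / 2)) in *.
set (e2 := Z.to_nat (r * (r - 1) / 2)) in *.
set (e3 := Z.to_nat ((r + 1) * (r + 1 + 1) / 2)) in *.
set (e4 := Z.to_nat ((r + 1) * (r + 1 - 1) / 2)) in *.
rewrite !Cpow_mult_l.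
transitivity (a ^ (S m + e1) * b ^ (m + e2)).
- rewrite !Cpow_add_r, Cpow_S. ring.
- replace (S m + e1)%nat with (j + e3)%nat by nia.
  replace (m + e2)%nat with (j + e4)%nat by nia.
  rewrite !Cpow_add_r. ring.
Qed.

Lemma theta_term_down (a b : C) (m j : nat) (r : Z) :
  (Z.of_nat m + r)%Z = Z.of_nat j ->
  b * (a * b) ^ m * theta_term a b r = (a * b) ^ j * theta_term a b (r - 1).
Proof.
intros H. unfold theta_term.
destruct (theta_exponents r) as [H1 H2].
destruct (theta_exponents (r - 1)) as [H3 H4].
set (e1 := Z.to_nat (r * (r + 1) / 2)) in *.
set (e2 := Z.to_nat (r * (r - 1) / 2)) in *.
set (e3 := Z.to_nat ((r - 1) * (r - 1 + 1) / 2)) in *.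
set (e4 := Z.to_nat ((r - 1) * (r - 1 - 1) / 2)) in *.
rewrite !Cpow_mult_l.
transitivity (a ^ (m + e1) * b ^ (S m + e2)).
- rewrite !Cpow_add_r, Cpow_S. ring.
- replace (m + e1)%nat with (j + e3)%nat by nia.
  replace (S m + e2)%nat with (j + e4)%nat by nia.
  rewrite !Cpow_add_r. ring.
Qed.

(** The finite triple product, free of divisions; [1 + a (a b) ^ N] extends the
    sum to the right and [1 + b (a b) ^ N] to the left. *)
Lemma jacobi_finite (a b : C) (N : nat) :
  csum (fun k => gauss_binom (a * b) (2 * N) k
                 * theta_term a b (Z.of_nat k - Z.of_nat N)) (S (2 * N))
  = qpoch (- a) (a * b) N * qpoch (- b) (a * b) N.
Proof.
induction N as [|N IH].
- unfold theta_term. simpl. ring.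
- replace (2 * S N)%nat with (S (S (2 * N))) by lia.
  cbn [qpoch].
  transitivity ((1 + b * (a * b) ^ N) * ((1 + a * (a * b) ^ N)
    * (qpoch (- a) (a * b) N * qpoch (- b) (a * b) N))); [|ring].
  rewrite <- IH, gauss_binom_sum_up.
  + rewrite <- (gauss_binom_sum_down _ (b * (a * b) ^ N)).
    * f_equal. apply csum_ext. intros k. do 2 f_equal. lia.
    * intros k. rewrite (theta_term_down a b N k) by lia. do 2 f_equal. lia.
  + intros k Hk. rewrite (theta_term_up a b N (2 * N - k)) by lia.
    do 2 f_equal. lia.
Qed.

Lemma csum_split (f : nat -> C) (N M : nat) :
  csum f (N + M)
  = csum (fun r => f (N + r)%nat) M + csum (fun r => f (N - S r)%nat) N.
Proof.
revert M. induction N as [|N IH]; intros M.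
{ exact (eq_sym (Cplus_0_r (csum f M))). }
replace (S N + M)%nat with (N + S M)%nat by lia.
rewrite IH, csum_shift, (csum_shift _ N), Nat.add_0_r.
rewrite (csum_ext (fun r => f (S N + r)%nat) (fun r => f (N + S r)%nat))
  by (intros; f_equal; lia).
change (S N - 1)%nat with (N - 0)%nat. rewrite Nat.sub_0_r.
change (fun k => f (S N - S (S k))%nat) with (fun k => f (N - S k)%nat).
ring.
Qed.

Lemma Csums_finite (f : nat -> C) (n : nat) :
  (forall k, (n <= k)%nat -> f k = 0) -> Csums f (csum f n).
Proof.
intros H. apply Cconv_squeeze with (fun m => Cmod (csum f m - csum f n)).
- intros; apply Rle_refl.
- apply is_lim_seq_incr_n with (N := n).
  apply is_lim_seq_ext with (fun _ => 0%R); [|apply is_lim_seq_const].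
  induction n0 as [|m IH].
  + simpl. replace (csum f n - csum f n) with (RtoC 0) by ring.
    now rewrite Cmod_0.
  + simpl csum. rewrite H by lia. rewrite Cplus_0_r. exact IH.
Qed.

Lemma gauss_binom_eq (q : C) (k j : nat) : (Cmod q < 1)%R ->
  gauss_binom q (k + j) k = qpoch q q (k + j) * / (qpoch q q k * qpoch q q j).
Proof.
intros hq. rewrite <- gauss_binom_qpoch. field.
split; now apply qpoch_neq_0.
Qed.

Lemma Cmod_gauss_binom_le (q : C) (M k : nat) : (Cmod q < 1)%R ->
  (Cmod (gauss_binom q M k) <= exp (Cmod q / (1 - Cmod q))
    * (exp (Cmod q / ((1 - Cmod q) * (1 - Cmod q)))
       * exp (Cmod q / ((1 - Cmod q) * (1 - Cmod q)))))%R.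
Proof.
intros hq.
assert (P1 := exp_pos (Cmod q / (1 - Cmod q))).
assert (P2 := exp_pos (Cmod q / ((1 - Cmod q) * (1 - Cmod q)))).
destruct (le_lt_dec k M) as [H|H].
- replace M with (k + (M - k))%nat by lia.
  rewrite gauss_binom_eq by exact hq.
  assert (I : forall n, (Cmod (/ qpoch q q n)
    <= exp (Cmod q / ((1 - Cmod q) * (1 - Cmod q))))%R).
  { intros n. assert (N := qpoch_neq_0 q q n hq hq).
    rewrite Cmod_inv by exact N.
    assert (B := Cmod_qpoch_ge q q _ n hq (Rle_refl _) hq).
    rewrite exp_Ropp in B.
    apply Rinv_le_contravar in B; [|now apply Rinv_0_lt_compat].
    now rewrite Rinv_inv in B. }
  assert (E : / (qpoch q q k * qpoch q q (M - k))
    = / qpoch q q k * / qpoch q q (M - k)).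
  { field. split; now apply qpoch_neq_0. }
  rewrite E, !Cmod_mult.
  apply Rmult_le_compat; [apply Cmod_ge_0 | | now apply Cmod_qpoch_le |].
  + apply Rmult_le_pos; apply Cmod_ge_0.
  + apply Rmult_le_compat; try apply Cmod_ge_0; apply I.
- rewrite gauss_binom_gt by exact H. rewrite Cmod_0.
  left. repeat apply Rmult_lt_0_compat; assumption.
Qed.

Lemma gauss_binom_lim (q : C) (r : nat) : (Cmod q < 1)%R ->
  Cconv (fun N => gauss_binom q (2 * N) (N + r)) (/ qpoch_inf q q).
Proof.
intros hq. apply (is_lim_seq_incr_n _ r).
assert (Nz := qpoch_inf_neq_0 q q hq hq).
assert (L := qpoch_inf_Cconv q q hq).
change (Cconv (fun n => gauss_binom q (2 * (n + r)) (n + r + r))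
  (/ qpoch_inf q q)).
apply Cconv_ext with (fun n => qpoch q q (2 * n + 2 * r)
  * / (qpoch q q (n + 2 * r) * qpoch q q n)).
- intros n. replace (2 * (n + r))%nat with (n + 2 * r + n)%nat by lia.
  replace (n + r + r)%nat with (n + 2 * r)%nat by lia.
  rewrite gauss_binom_eq by exact hq.
  now replace (2 * n + 2 * r)%nat with (n + 2 * r + n)%nat by lia.
- replace (/ qpoch_inf q q)
    with (qpoch_inf q q * / (qpoch_inf q q * qpoch_inf q q)) by now field.
  apply Cconv_mult.
  + apply Cconv_subseq with (phi := fun n => (2 * n + 2 * r)%nat);
      [intros; lia | exact L].
  + apply Cconv_inv; [| now apply Cmult_neq_0 |].
    * intros n. apply Cmult_neq_0; now apply qpoch_neq_0.
    * apply Cconv_mult; [|exact L].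
      apply Cconv_subseq with (phi := fun n => (n + 2 * r)%nat);
        [intros; lia | exact L].
Qed.

Lemma CSeries_scal (c : C) (f : nat -> C) :
  ex_series f -> CSeries (fun n => c * f n) = c * CSeries f.
Proof. intros H. now apply CSeries_Csums, Csums_scal, ex_series_Csums. Qed.

(** In the finite identity the coefficient of the term of index [r] is the
    Gaussian binomial [2 N, N + r], bounded uniformly and tending to
    1 / (ab; ab)_oo. The symmetry of these binomials lets the halves [r >= 0] and
    [r < 0] be treated alike. *)
Lemma jacobi_triple_product (a b : C) : (Cmod (a * b) < 1)%R ->
  theta a b = qpoch_inf (- a) (a * b) * qpoch_inf (- b) (a * b)
              * qpoch_inf (a * b) (a * b).
Proof.
intros hp. set (p := a * b) in *.
assert (Nz := qpoch_inf_neq_0 p p hp hp).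
destruct (theta_cvg a b hp) as [X1 X2].
destruct (ex_series_Cmod_theta_term a b hp) as [A1 A2].
set (K := (exp (Cmod p / (1 - Cmod p))
    * (exp (Cmod p / ((1 - Cmod p) * (1 - Cmod p)))
       * exp (Cmod p / ((1 - Cmod p) * (1 - Cmod p)))))%R).
assert (Half : forall (t : nat -> C) (d : nat), ex_series t ->
  ex_series (fun k => Cmod (t k)) ->
  Cconv (fun N => csum (fun r => gauss_binom p (2 * N) (N + (r + d)) * t r)
                    (S N)) (/ qpoch_inf p p * CSeries t)).
{ intros t d Et At. rewrite <- CSeries_scal by exact Et.
  apply (Csums_dominated
    (fun N r => gauss_binom p (2 * N) (N + (r + d)) * t r)
    _ (fun r => K * Cmod (t r))%R).
  - intros N r. rewrite Cmod_mult.
    apply Rmult_le_compat_r; [apply Cmod_ge_0 | now apply Cmod_gauss_binom_le].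
  - now apply @ex_series_scal_l.
  - intros r. apply Cconv_mult; [now apply gauss_binom_lim | apply Cconv_const].
  - intros N. apply Csums_finite. intros r Hr.
    rewrite gauss_binom_gt by lia. ring. }
assert (L : Cconv (fun N => qpoch (- a) p N * qpoch (- b) p N)
  (/ qpoch_inf p p * theta a b)).
{ unfold theta, CSeries_Z. rewrite Cmult_plus_distr_l.
  eapply Cconv_ext; [|apply Cconv_plus;
    [apply (Half _ 0%nat X1 A1) | apply (Half _ 1%nat X2 A2)]].
  intros N. unfold p. rewrite <- jacobi_finite. fold p.
  replace (S (2 * N)) with (N + S N)%nat by lia. rewrite csum_split.
  f_equal.
  - apply csum_ext. intros r. rewrite Nat.add_0_r. do 2 f_equal. lia.
  - cbn [csum]. rewrite (gauss_binom_gt p (2 * N) (N + (N + 1))) by lia.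
    rewrite Cmult_0_l, Cplus_0_r. apply csum_ext_lt. intros r Hr. f_equal.
    + (* the symmetry [M, k] = [M, M - k] *)
      replace (2 * N)%nat with (N + (r + 1) + (N - S r))%nat at 1 by lia.
      replace (2 * N)%nat with (N - S r + (N + (r + 1)))%nat by lia.
      rewrite !gauss_binom_eq by exact hp.
      rewrite (Cmult_comm (qpoch p p (N + (r + 1)))).
      now rewrite (Nat.add_comm (N + (r + 1))).
    + f_equal. lia. }
assert (E := Cconv_unique _ _ _ L (Cconv_mult _ _ _ _
  (qpoch_inf_Cconv (- a) p hp) (qpoch_inf_Cconv (- b) p hp))).
rewrite <- E. now field.
Qed.

(** * Ramanujan's psi function *)

Lemma psi_product (q : C) : (Cmod q < 1)%R ->
  psi q = qpoch_inf (- q) (q ^ 2) * qpoch_inf (q ^ 4) (q ^ 4).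
Proof.
intros hq. unfold psi.
assert (hq2 := Cmod_pow_lt_1 q 2 ltac:(lia) hq).
assert (hq4 := Cmod_pow_lt_1 q 4 ltac:(lia) hq).
assert (E : q * q ^ 3 = q ^ 4) by ring.
rewrite jacobi_triple_product; rewrite E; [|exact hq4].
rewrite (qpoch_inf_even (- q) (q ^ 2)) by exact hq2.
replace (- q * q ^ 2) with (- q ^ 3) by ring.
now replace ((q ^ 2) ^ 2) with (q ^ 4) by ring.
Qed.

Lemma psi_opp_product (q : C) : (Cmod q < 1)%R ->
  psi (- q) = qpoch_inf q (q ^ 2) * qpoch_inf (q ^ 4) (q ^ 4).
Proof.
intros hq. rewrite psi_product by (now rewrite Cmod_opp).
replace (- - q) with q by ring.
replace ((- q) ^ 2) with (q ^ 2) by ring.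
now replace ((- q) ^ 4) with (q ^ 4) by ring.
Qed.

Lemma psi_opp_quotient (q : C) : (Cmod q < 1)%R ->
  psi (- q) * qpoch_inf (- q) (q ^ 2) = qpoch_inf (q ^ 2) (q ^ 2).
Proof.
intros hq. assert (hq2 := Cmod_pow_lt_1 q 2 ltac:(lia) hq).
rewrite psi_opp_product by exact hq.
rewrite (qpoch_inf_even (q ^ 2) (q ^ 2)) by exact hq2.
rewrite <- (qpoch_inf_opp q (q ^ 2)) by exact hq2.
replace (q ^ 2 * q ^ 2) with (q ^ 4) by ring.
replace ((q ^ 2) ^ 2) with (q ^ 4) by ring. ring.
Qed.

Lemma psi_opp_neq_0 (q : C) : (Cmod q < 1)%R -> psi (- q) <> 0.
Proof.
intros hq. rewrite psi_opp_product by exact hq.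
apply Cmult_neq_0; apply qpoch_inf_neq_0;
  solve [assumption | apply Cmod_pow_lt_1; [lia | exact hq]].
Qed.

Lemma psi_term (q : C) (n : Z) :
  theta_term q (q ^ 3) n = q ^ Z.to_nat (2 * n * n - n).
Proof.
unfold theta_term. destruct (theta_exponents n) as [H1 H2].
rewrite <- Cpow_mult_r, <- Cpow_add_r. f_equal. nia.
Qed.

Lemma theta_2_14_term (q : C) (n : Z) :
  theta_term (q ^ 2) (q ^ 14) n = q ^ Z.to_nat (8 * n * n - 6 * n).
Proof.
unfold theta_term. destruct (theta_exponents n) as [H1 H2].
rewrite <- !Cpow_mult_r, <- Cpow_add_r. f_equal. nia.
Qed.

Lemma Cpow_opp_even (q : C) (n : nat) : (- q) ^ (2 * n) = q ^ (2 * n).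
Proof. rewrite !Cpow_mult_r. now replace ((- q) ^ 2) with (q ^ 2) by ring. Qed.

Lemma psi_term_even (q : C) (m : Z) :
  theta_term q (q ^ 3) (2 * m) - theta_term (- q) ((- q) ^ 3) (2 * m) = 0.
Proof.
rewrite !psi_term.
replace (Z.to_nat (2 * (2 * m) * (2 * m) - 2 * m))
  with (2 * Z.to_nat (4 * m * m - m))%nat by nia.
rewrite Cpow_opp_even. ring.
Qed.

Lemma psi_term_odd (q : C) (m : Z) :
  theta_term q (q ^ 3) (2 * m + 1) - theta_term (- q) ((- q) ^ 3) (2 * m + 1)
  = 2 * q * theta_term (q ^ 2) (q ^ 14) (- m).
Proof.
rewrite !psi_term, theta_2_14_term.
assert (0 <= 4 * m * m + 3 * m)%Z.
{ assert (m <= -1 \/ m = 0 \/ 1 <= m)%Z by lia. nia. }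
replace (Z.to_nat (2 * (2 * m + 1) * (2 * m + 1) - (2 * m + 1)))
  with (S (2 * Z.to_nat (4 * m * m + 3 * m))) by nia.
replace (Z.to_nat (8 * - m * - m - 6 * - m))
  with (2 * Z.to_nat (4 * m * m + 3 * m))%nat by nia.
rewrite !Cpow_S, Cpow_opp_even. ring.
Qed.

(** The odd part of [psi q = sum_n q ^ (2 n^2 - n)]: the exponent has the parity
    of [n], and [n = 2 m + 1] gives [1 + 8 m^2 + 6 m]. *)
Lemma psi_odd_part (q : C) : (Cmod q < 1)%R ->
  psi q - psi (- q) = 2 * q * theta (q ^ 2) (q ^ 14).
Proof.
intros hq.
assert (Cv : forall x, (Cmod x < 1)%R -> ex_CSeries_Z (theta_term x (x ^ 3))).
{ intros x hx. apply theta_cvg. replace (x * x ^ 3) with (x ^ 4) by ring.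
  apply Cmod_pow_lt_1; [lia | exact hx]. }
destruct (Cv q hq) as [P1 N1].
destruct (Cv (- q) ltac:(now rewrite Cmod_opp)) as [P2 N2].
assert (T : ex_CSeries_Z (theta_term (q ^ 2) (q ^ 14))).
{ apply theta_cvg. replace (q ^ 2 * q ^ 14) with (q ^ 16) by ring.
  apply Cmod_pow_lt_1; [lia | exact hq]. }
destruct T as [PT NT].
apply ex_series_Csums in P1, N1, P2, N2, PT, NT.
unfold psi, theta, CSeries_Z.
set (p1 := CSeries _) in P1. set (n1 := CSeries _) in N1.
set (p2 := CSeries _) in P2. set (n2 := CSeries _) in N2.
set (pt := CSeries _) in PT. set (nt := CSeries _) in NT.
fold p1 n1 p2 n2 pt nt.
set (th := theta_term (q ^ 2) (q ^ 14)) in *.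
assert (D : forall f g (l m : C), Csums f l -> Csums g m ->
  Csums (fun k => f k - g k) (l - m)).
{ intros f g l m Hf Hg.
  apply Csums_ext with (fun k => f k + (- (1)) * g k); [intros; ring|].
  replace (l - m) with (l + (- (1)) * m) by ring.
  apply Csums_plus; [exact Hf | now apply Csums_scal]. }
assert (Pos : p1 - p2 = 2 * q * (th 0%Z + nt)).
{ apply Cconv_unique with (csum (fun k => 2 * q * th (- Z.of_nat k)%Z)).
  - apply Csums_pairs with (2 := D _ _ _ _ P1 P2). intros k. cbv beta.
    replace (Z.of_nat (2 * k)) with (2 * Z.of_nat k)%Z by lia.
    replace (Z.of_nat (2 * k + 1)) with (2 * Z.of_nat k + 1)%Z by lia.
    rewrite psi_term_even, psi_term_odd. apply Cplus_0_l.
  - apply Csums_scal.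
    exact (Csums_decr_1 (fun k => th (- Z.of_nat k)%Z) nt NT). }
assert (Neg : n1 - n2 = 2 * q * (pt - th 0%Z)).
{ apply Cconv_unique with (csum (fun k => 2 * q * th (Z.of_nat (S k)))).
  - apply Csums_pairs with (2 := D _ _ _ _ N1 N2). intros k. cbv beta.
    replace (- Z.of_nat (S (2 * k)))%Z with (2 * - Z.of_nat (S k) + 1)%Z by lia.
    replace (- Z.of_nat (S (2 * k + 1)))%Z with (2 * - Z.of_nat (S k))%Z by lia.
    rewrite psi_term_even, psi_term_odd, Z.opp_involutive. apply Cplus_0_r.
  - apply Csums_scal.
    exact (Csums_incr_1 (fun k => th (Z.of_nat k)) pt PT). }
transitivity ((p1 - p2) + (n1 - n2)); [ring|]. rewrite Pos, Neg. ring.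
Qed.

(** * Evaluation of the series *)

Definition slater_term (q : C) (k : nat) : C :=
  q ^ (k * (k + 2)) * qpoch (- q ^ 2) (q ^ 2) k / qpoch q q (2 * k + 2).

Lemma gauss_term_slater (q : C) (k : nat) : (Cmod q < 1)%R ->
  gauss_term (- (1)) q (- (1)) (S k) = 2 * q * slater_term q k.
Proof.
intros hq. unfold gauss_term, slater_term.
assert (hq2 := Cmod_pow_lt_1 q 2 ltac:(lia) hq).
replace (2 * k + 2)%nat with (2 * S k)%nat by lia.
rewrite qpoch_even.
assert (N1 := qpoch_neq_0 (q ^ 2) (q ^ 2) (S k) hq2 hq2).
assert (N2 := qpoch_neq_0 q (q ^ 2) (S k) hq2 hq).
replace (- (1) * q * - (1)) with q by ring.
replace (q * q) with (q ^ 2) by ring.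
replace (- - (1)) with (RtoC 1) by ring.
rewrite Cpow_1_l, (qpoch_S_shift (- (1))).
replace (- (1) * q ^ 2) with (- q ^ 2) by ring.
replace (S k * S k)%nat with (S (k * (k + 2))) by lia.
rewrite Cpow_S. field. now split.
Qed.


(** The q-Gauss sum at [a = y = -1] is [psi q / psi (- q)], and its excess over
    [1] is given by the odd part of [psi]. *)
Lemma slater_sum (q : C) : (Cmod q < 1)%R ->
  Csums (slater_term q) (theta (q ^ 2) (q ^ 14) / psi (- q)).
Proof.
intros hq. assert (Nz := psi_opp_neq_0 q hq).
destruct (Ceq_dec q 0) as [->|hq0].
- (* the factor [q] cannot be cancelled, but only the first term is left *)
  assert (E : theta (0 ^ 2) (0 ^ 14) = psi (- 0)).
  { unfold psi. f_equal; ring. }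
  rewrite E.
  replace (psi (- 0) / psi (- 0)) with (slater_term 0 0 + 0).
  2:{ replace (psi (- 0) / psi (- 0)) with (RtoC 1) by now field.
      unfold slater_term. simpl. field. }
  apply Csums_decr_1.
  apply Csums_ext with (fun k => 0 * slater_term 0 (S k)).
  { intros k. unfold slater_term.
    replace (S k * (S k + 2))%nat with (S (k * k + 4 * k + 2)) by lia.
    rewrite Cpow_S. unfold Cdiv. ring. }
  apply Cconv_ext with (fun _ => RtoC 0); [|apply Cconv_const].
  intros n. rewrite csum_scal. ring.
- set (G := CSeries (gauss_term (- (1)) q (- (1)))).
  assert (E : - (1) * q * - (1) = q) by ring.
  assert (HG : Csums (gauss_term (- (1)) q (- (1))) G).
  { apply Csums_gauss_term; [|rewrite E]; exact hq. }
  assert (V : G * psi (- q) = psi q).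
  { rewrite psi_opp_product, psi_product by exact hq.
    assert (S := gauss_sum (- (1)) q (- (1)) hq ltac:(rewrite E; exact hq)).
    rewrite E in S. replace (q * - (1)) with (- q) in S by ring.
    rewrite <- S. unfold G. ring. }
  assert (O := psi_odd_part q hq).
  apply Csums_incr_1 in HG.
  apply Csums_scal with (c := / (2 * q)) in HG.
  replace (theta (q ^ 2) (q ^ 14) / psi (- q))
    with (/ (2 * q) * (G - gauss_term (- (1)) q (- (1)) 0)).
  + apply Csums_ext with (2 := HG). intros k.
    rewrite gauss_term_slater by exact hq. field. exact hq0.
  + replace (gauss_term (- (1)) q (- (1)) 0) with (RtoC 1)
      by (unfold gauss_term; simpl; field).
    transitivity ((psi q - psi (- q)) / (2 * q * psi (- q))).
    * rewrite <- V. field. now split.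
    * rewrite O. field. now split.
Qed.

Theorem mainTheorem9 (q : C) (hq : (Cmod q < 1)%R) :
  let t := fun n : nat =>
    q ^ (n ^ 2 - 2) * qpoch (- q ^ 2) (q ^ 2) (n - 2) * (1 + q ^ (2 * n + 2))
    / qpoch q q (2 * n) in
  ex_series (fun k => t (2 + k)%nat) /\
  psi (- q) <> 0 /\
  qpoch_inf (q ^ 2) (q ^ 2) <> 0 /\
  1 + q / ((1 - q) * (1 - q ^ 2)) + CSeries_from 2 t
    = theta (q ^ 2) (q ^ 14) / psi (- q) /\
  theta (q ^ 2) (q ^ 14) / psi (- q)
    = qpoch_inf (- q ^ 2) (q ^ 16) * qpoch_inf (- q ^ 14) (q ^ 16)
      * qpoch_inf (q ^ 16) (q ^ 16) * qpoch_inf (- q) (q ^ 2)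
      / qpoch_inf (q ^ 2) (q ^ 2).
Proof.
intros t.
assert (hq2 := Cmod_pow_lt_1 q 2 ltac:(lia) hq).
assert (Nz := psi_opp_neq_0 q hq).
assert (Nz2 := qpoch_inf_neq_0 (q ^ 2) (q ^ 2) hq2 hq2).
assert (HS := slater_sum q hq).
set (S0 := theta (q ^ 2) (q ^ 14) / psi (- q)) in *.
set (w := fun k => (1 - q) * (q ^ (2 * k + 2) * slater_term q k)).
assert (Hw : Cconv w 0).
{ unfold w. replace (RtoC 0) with ((1 - q) * (0 * 0)) by ring.
  apply Cconv_scal, Cconv_mult; [|exact (Csums_lim_0 _ _ HS)].
  apply Cconv_subseq with (u := fun n => q ^ n) (phi := fun k => (2 * k + 2)%nat);
    [intros; lia|].
  apply Cconv_squeeze with (fun n => Cmod q ^ n)%R.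
  - intros n. replace (q ^ n - 0) with (q ^ n) by ring.
    rewrite Cmod_pow. apply Rle_refl.
  - apply is_lim_seq_geom. rewrite Rabs_pos_eq by apply Cmod_ge_0. exact hq. }
assert (Nq : forall n, qpoch q q n <> 0) by (intros; now apply qpoch_neq_0).
assert (Et : forall k, slater_term q (S k) + (w k - w (S k)) = t (2 + k)%nat).
{ intros k. unfold t, w, slater_term.
  assert (N1 := Nq (2 * k + 2)%nat). assert (N2 := Nq (2 * (2 + k))%nat).
  replace (2 + k - 2)%nat with k by lia.
  replace ((2 + k) ^ 2 - 2)%nat with (k * (k + 2) + (k + k + 2))%nat
    by (simpl; lia).
  replace (S k * (S k + 2))%nat with (k * (k + 2) + (k + k + 3))%nat by lia.
  replace (2 * (2 + k) + 2)%nat with (k + k + 6)%nat by lia.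
  replace (2 * S k + 2)%nat with (k + k + 4)%nat by lia.
  replace (2 * (2 + k))%nat with (k + k + 4)%nat in * by lia.
  replace (2 * k + 2)%nat with (k + k + 2)%nat in * by lia.
  replace (k + k + 4)%nat with (S (S (k + k + 2))) in * by lia.
  cbn [qpoch] in *.
  replace ((q ^ 2) ^ k) with (q ^ (k + k))
    by (rewrite <- Cpow_mult_r; f_equal; lia).
  rewrite !Cpow_S, !Cpow_add_r in *.
  set (x := q ^ k) in *. set (e := q ^ (k * (k + 2))) in *.
  set (A := qpoch (- q ^ 2) (q ^ 2) k) in *.
  set (D := qpoch q q (k + k + 2)) in *.
  replace (q ^ 2) with (q * q) in N2 by ring.
  assert (N3 : 1 - q * (x * x * (q * q)) <> 0).
  { intros Z. apply N2. rewrite Z. ring. }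
  assert (N4 : 1 - q * (q * (x * x * (q * q))) <> 0).
  { intros Z. apply N2. rewrite Z. ring. }
  clearbody x e A D. simpl.
  field. repeat split; assumption. }
assert (HT : Csums (fun k => t (2 + k)%nat) (S0 - slater_term q 0 + w O)).
{ apply Csums_ext with (1 := Et).
  apply Csums_plus; [now apply Csums_incr_1 | now apply Csums_telescope]. }
split; [eexists; apply Csums_is_series; exact HT|].
split; [exact Nz|]. split; [exact Nz2|]. split.
- unfold CSeries_from. rewrite (CSeries_Csums _ _ HT).
  unfold w, slater_term. assert (N := Nq 2%nat). simpl in N |- *.
  field. split; intros Z; apply N.
  + transitivity ((1 - q) * (1 - q * q)); [ring | rewrite Z; ring].
  + transitivity ((1 - q) * (1 - q * q)); [ring | rewrite Z; ring].
- unfold S0. rewrite jacobi_triple_product.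
  + replace (q ^ 2 * q ^ 14) with (q ^ 16) by ring.
    assert (P := psi_opp_quotient q hq). rewrite <- P. field. split; [|exact Nz].
    intros Z. apply Nz2. rewrite <- P, Z. ring.
  + replace (q ^ 2 * q ^ 14) with (q ^ 16) by ring.
    apply Cmod_pow_lt_1; [lia | exact hq].
Qed.
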